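(* Let $G$ be a unicyclic graph of Type $II$, let $C$ be its cycle, and let $T_1,\ldots,T_k$ be the connected components of $G-C$, so that $G-C=\bigcup_{i=1}^{k}T_i$. Then $$\nu(G)=\left\lfloor\frac{|V(C)|}{2}\right\rfloor+\sum_{i=1}^{k}\left(|Core(T_i)|+\frac{|V(\mathcal{F}_N(T_i))|}{2}\right).$$
   Context: All graphs are finite and simple. A unicyclic graph is a connected graph containing exactly one cycle. For a graph $H$ with adjacency matrix $A(H)$, $\mathcal{N}(H)=\{x\in\mathbb{R}^{V(H)}: A(H)x=0\}$ and the support of $H$ is $Supp(H)=\{u\in V(H): x_u\neq 0 \text{ for some } x\in\mathcal{N}(H)\}$. The core of $H$ is $Core(H)=\bigcup_{u\in Supp(H)}N(u)$, where $N(u)$ is the set of neighbors of $u$ in $H$. For a subgraph $H$ of $G$, $G-H$ is the subgraph of $G$ induced by $V(G)\setminus V(H)$. $\nu(G)$ denotes the matching number of $G$ (the size of a maximum matching). For a unicyclic graph $G$ with cycle $C$ and $v\in V(C)$, the pendant tree $G\{v\}$ of $G$ at $v$ is the induced connected subgraph of $G$ with the maximum possible number of vertices which contains $v$ and no other vertex of $C$ (it may consist of $v$ alone). The vertex $v$ is called mismatched in $G\{v\}$ if some maximum matching of $G\{v\}$ does not saturate $v$ (if $G\{v\}$ consists of a single vertex, $v$ is mismatched), and matched in $G\{v\}$ otherwise. $G$ is of Type $I$ if some vertex $v\in V(C)$ is matched in $G\{v\}$; otherwise $G$ is of Type $II$. For a tree $T$, the $S$-forest $\mathcal{F}_S(T)$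 is the subgraph of $T$ induced by the closed neighborhood $N[Supp(T)]$, i.e. by $Supp(T)$ together with all neighbors of vertices of $Supp(T)$; the $N$-forest is $\mathcal{F}_N(T)=T-\mathcal{F}_S(T)$. *)

(* Defs.v *)
From HB Require Import structures.
From mathcomp Require Import all_boot all_order all_algebra.
From mathcomp Require Import boolp reals.

Set Implicit Arguments.
Unset Strict Implicit.
Unset Printing Implicit Defensive.

Import GRing.Theory.

(* A finite simple graph is a symmetric irreflexive relation e on a finType T.
   Every other graph involved is an induced subgraph e[V], V : {set T}, and all
   notions below are those of e[V]; the whole graph is the case V = [set: T]. *)
Section Graph.
Variables (T : finType) (e : rel T).
Implicit Types (V P : {set T}) (M : {set {set T}}) (c : seq T) (u v : T).

Definition simple_graph := symmetric e /\ irreflexive e.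

Definition adj V : rel T := [rel x y | [&& x \in V, y \in V & e x y]].

Definition neighbors V u : {set T} := [set w | adj V u w].

Definition edges V : {set {set T}} := [set [set x; y] | x in V, y in V & e x y].

Definition connected V : bool :=
  [forall x in V, forall y in V, connect (adj V) x y].

Definition components V : {set {set T}} :=
  equivalence_partition (connect (adj V)) V.

Definition matching V M : bool := (M \subset edges V) && trivIset M.

Definition matching_number V : nat := \max_(M | matching V M) #|M|.

Definition maximum_matching V M : bool :=
  matching V M && (#|M| == matching_number V).

Definition saturates M v : bool := v \in cover M.

Definition mismatched V v : bool :=
  [exists M, maximum_matching V M && ~~ saturates M v].

Definition matched V v : bool := ~~ mismatched V v.

(* A cycle is listed by a duplicate-free closed walk c of length at least 3;
   two lists give the same cycle (as a subgraph) iff their edge sets agree. *)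
Definition graph_cycle c : bool := (2 < size c) && ucycleb e c.

Definition cycle_vertices c : {set T} := [set x in c].

Definition cycle_edges c : {set {set T}} := [set [set x; next c x] | x in c].

Definition unicyclic : Prop :=
  connected [set: T] /\
  exists! E : {set {set T}}, exists2 c, graph_cycle c & cycle_edges c = E.

(* For v on the cycle c, [set v] is a candidate, so the argmax is genuine. *)
Definition pendant_tree c v : {set T} :=
  [arg max_(P > [set v] | connected P && (P :&: cycle_vertices c == [set v]))
     #|P|]%N.

Definition typeI c : bool :=
  [exists v in cycle_vertices c, matched (pendant_tree c v) v].

Definition typeII c : bool := ~~ typeI c.

Variable R : realType.

Definition adjacency_matrix V : 'M[R]_#|V| :=
  (\matrix_(i, j) (e (enum_val i) (enum_val j))%:R)%R.

Definition null_space V (x : 'cV[R]_#|V|) : Prop :=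
  (adjacency_matrix V *m x = 0)%R.

Definition Supp V : {set T} :=
  [set enum_val i | i : 'I_#|V| &
    `[< exists2 x, null_space x & (x i ord0 != 0)%R >]].

Definition Core V : {set T} := \bigcup_(u in Supp V) neighbors V u.

Definition S_forest V : {set T} :=
  Supp V :|: \bigcup_(u in Supp V) neighbors V u.

Definition N_forest V : {set T} := V :\: S_forest V.

End Graph.

(* Main.v *)
Require Import Defs.
From HB Require Import structures.
From mathcomp Require Import all_boot all_order all_algebra.
From mathcomp Require Import boolp reals.

Set Implicit Arguments.
Unset Strict Implicit.
Unset Printing Implicit Defensive.

(** If two pendant trees met, a path through them would close up with an arc of
the cycle [C] to a second cycle; so the pendant trees are disjoint; by
maximality they contain every edge that is not inside [C]. In Type II deleting
the root of a pendant tree does not change its matching number, whence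
[nu(G) <= |C|/2 + nu(G - C)]; the converse is clear since [C] has a matching of
size [|C|/2].

For a forest on [V], [2 nu = 2 |Core| + |N|] follows by deleting a leaf [u] and
its neighbour [w]. A null vector vanishes at [w], and its value at [u] is minus
its sum over the other neighbours of [w]. If none of these is in the support of
the rest, the support and the core do not change and [u], [w] join the
[N]-forest; otherwise [u] joins the support and [w] the core, because a null
vector can be restricted to a component and a component meets the neighbours of
[w] at most once. *)

(** * Matchings of induced subgraphs *)

Section Matchings.
Variables (T : finType) (e : rel T).
Hypotheses (e_sym : symmetric e) (e_irr : irreflexive e).
Implicit Types (V A B : {set T}) (M : {set {set T}}).

Lemma edgesP V (E : {set T}) :
  reflect (exists x y, [/\ x \in V, y \in V, e x y & E = [set x; y]])
          (E \in edges e V).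
Proof.
apply: (iffP imset2P) => [[x y xV]|[x [y [xV yV exy ->]]]].
  by rewrite inE => /andP[yV exy] ->; exists x, y.
by exists x y; rewrite ?inE ?yV.
Qed.

Lemma edge_card V (E : {set T}) : E \in edges e V -> #|E| = 2.
Proof.
case/edgesP=> x [y [_ _ exy ->]]; rewrite cards2.
by case: eqVneq exy => // ->; rewrite e_irr.
Qed.

Lemma edge_sub V (E : {set T}) : E \in edges e V -> E \subset V.
Proof. by case/edgesP=> x [y [xV yV _ ->]]; rewrite subUset !sub1set xV. Qed.

Lemma edges_induced V A (E : {set T}) :
  E \in edges e V -> E \subset A -> E \in edges e A.
Proof.
case/edgesP=> x [y [_ _ exy ->]]; rewrite subUset !sub1set => /andP[xA yA].
by apply/edgesP; exists x, y.
Qed.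

Lemma edgesS A B : A \subset B -> edges e A \subset edges e B.
Proof.
move=> sAB; apply/subsetP=> E EA; apply: (edges_induced EA).
exact: subset_trans (edge_sub EA) sAB.
Qed.

Lemma leq_matching_number V M : matching e V M -> #|M| <= matching_number e V.
Proof. exact: (@leq_bigmax_cond _ (matching e V) (fun M => #|M|)). Qed.

Lemma matching_number_attained V :
  exists2 M, matching e V M & #|M| = matching_number e V.
Proof.
have : 0 < #|[pred M | matching e V M]|.
  apply/card_gt0P; exists set0; rewrite inE /matching sub0set.
  by apply/trivIsetP => ? ?; rewrite inE.
by move=> /(eq_bigmax_cond (fun M => #|M|)) [M MM eqM]; exists M.
Qed.

Lemma cover_matching V M : matching e V M -> cover M \subset V.
Proof.
case/andP=> /subsetP sM _; apply/bigcupsP=> E /sM; exact: edge_sub.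
Qed.

Lemma matching_meet V M A :
  matching e V M -> matching e A (M :&: edges e A).
Proof.
case/andP=> _ tM; rewrite /matching subsetIr /=.
exact: trivIsetS (subsetIl _ _) tM.
Qed.

Lemma matching_numberS A B :
  A \subset B -> matching_number e A <= matching_number e B.
Proof.
move=> sAB; have [M /andP[sM tM] <-] := matching_number_attained A.
by apply: leq_matching_number; rewrite /matching tM (subset_trans sM (edgesS sAB)).
Qed.

Lemma matching_number_half V : matching_number e V <= #|V| %/ 2.
Proof.
have [M MM <-] := matching_number_attained V.
rewrite leq_divRL // -sum_nat_const; have /andP[sM tM] := MM.
apply: leq_trans (subset_leq_card (cover_matching MM)).
(* By [trivIset], [#|cover M|] is the sum of the sizes of the edges, and each size is 2. *)
rewrite -(eqP tM) leq_eqVlt; apply/orP; left; apply/eqP.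
by apply: eq_bigr => E /(subsetP sM)/edge_card.
Qed.

(** A maximum matching is counted edge by edge: an edge outside [e[A]] contributes to at least one
    summand. The [F i] may overlap, which can only enlarge the sum. *)
Lemma matching_number_cover (I : finType) (P : pred I) (F : I -> {set T}) V A :
  (forall E, E \in edges e V ->
     E \in edges e A \/ exists2 i, P i & E \in edges e (F i)) ->
  matching_number e V <=
    matching_number e A + \sum_(i | P i) matching_number e (F i).
Proof.
move=> cov; have [M MM <-] := matching_number_attained V.
have leF B : #|M :&: edges e B| <= matching_number e B.
  by apply: leq_matching_number; apply: matching_meet MM.
apply: (leq_trans _ (leq_add (leF A) (leq_sum _ (fun i _ => leF (F i))))).
rewrite -(cardsID (edges e A) M) leq_add2l.
(* Sizes become sums of indicators, so that summation over [i] and over the edges can be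
   exchanged. *)
have cI B : #|M :&: edges e B| = \sum_(E in M) (E \in edges e B).
  rewrite -sum1_card (eq_bigl (fun E => (E \in M) && (E \in edges e B))).
    by rewrite big_mkcondr; apply: eq_bigr => E _; case: (_ \in _).
  by move=> E; rewrite inE.
rewrite (eq_bigr _ (fun i _ => cI (F i))) exchange_big /= -sum1_card.
rewrite (eq_bigl (fun E => (E \in M) && (E \notin edges e A))); last first.
  by move=> E; rewrite inE andbC.
rewrite big_mkcondr; apply: leq_sum => E EM; case: ifP => // EnA.
have /andP[/subsetP/(_ E EM) EV _] := MM.
case: (cov E EV) => [EA|[i Pi EF]]; first by rewrite EA in EnA.
by rewrite (bigD1 i) //= EF.
Qed.

Lemma matching_numberU A B : [disjoint A & B] ->
  matching_number e A + matching_number e B <= matching_number e (A :|: B).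
Proof.
move=> dAB; have [M MM <-] := matching_number_attained A.
have [N MN <-] := matching_number_attained B.
have cM := cover_matching MM; have cN := cover_matching MN.
have /andP[sM tM] := MM; have /andP[sN tN] := MN.
have dis E F : E \in M -> F \in N -> [disjoint E & F].
  move=> EM FN; apply: disjointWl (edge_sub (subsetP sM _ EM)) _.
  exact: disjointWr (edge_sub (subsetP sN _ FN)) dAB.
(* An edge in both matchings would be disjoint from itself, yet it has two elements. *)
have dMN : M :&: N = set0.
  apply/setP=> E; rewrite !inE; apply/andP=> -[EM EN].
  have := dis _ _ EM EN; rewrite -setI_eq0 setIid => /eqP E0.
  by have := edge_card (subsetP sM _ EM); rewrite E0 cards0.
rewrite -cardsUI dMN cards0 addn0; apply: leq_matching_number.
apply/andP; split.
  rewrite subUset (subset_trans sM) ?edgesS ?subsetUl //=.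
  by rewrite (subset_trans sN) ?edgesS ?subsetUr.
apply/trivIsetP=> E F; rewrite !inE => /orP[EM|EN] /orP[FM|FN] nEF.
- exact: (trivIsetP tM).
- exact: dis.
- by rewrite disjoint_sym dis.
- exact: (trivIsetP tN).
Qed.

Lemma matching_number_bigcup (I : finType) (P : pred I) (F : I -> {set T}) V :
  (forall i, P i -> F i \subset V) ->
  (forall i j, P i -> P j -> i != j -> [disjoint F i & F j]) ->
  \sum_(i | P i) matching_number e (F i) <= matching_number e V.
Proof.
move=> sF dF; apply: leq_trans (_ : _ <= matching_number e (\bigcup_(i | P i) F i)) _; last first.
  by apply: matching_numberS; apply/bigcupsP.
rewrite -!(big_filter (index_enum I)).
have: uniq [seq i <- index_enum I | P i] by rewrite filter_uniq ?index_enum_uniq.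
have: {subset [seq i <- index_enum I | P i] <= P}.
  by move=> i; rewrite mem_filter => /andP[].
elim: [seq i <- _ | P i] => [|i s IH] Ps /=; first by rewrite !big_nil.
case/andP=> nis us; rewrite !big_cons.
apply: leq_trans (matching_numberU _).
  by rewrite leq_add2l IH // => j js; apply: Ps; rewrite inE js orbT.
rewrite big_seq; apply: (big_ind (fun B : {set T} => [disjoint F i & B])).
- by rewrite -setI_eq0 setI0.
- by move=> A B; rewrite -!setI_eq0 setIUr => /eqP-> /eqP->; rewrite setU0.
move=> j js.
apply: dF; rewrite -?topredE /=; [exact/Ps/mem_head | by apply: Ps; rewrite inE js orbT |].
by apply: contraNneq nis => ->.
Qed.

Lemma matching_number_edge x y : e x y -> 0 < matching_number e [set x; y].
Proof.
move=> exy; rewrite -(cards1 [set x; y]); apply: leq_matching_number.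
rewrite /matching sub1set; apply/andP; split.
  by apply/edgesP; exists x, y; rewrite !inE !eqxx orbT.
by apply/trivIsetP=> E F /set1P-> /set1P->; rewrite eqxx.
Qed.

(** Every other edge of the path is taken, starting with the first; for an odd number of vertices
    the last one stays unsaturated. *)
Lemma matching_number_path (s : seq T) : uniq s -> sorted e s ->
  size s %/ 2 <= matching_number e [set x in s].
Proof.
have [n] := ubnP (size s); elim: n s => // n IH [|x [|y s]] // sz us ps.
have /and3P[nx ny us'] := us; have /andP[exy ps'] := ps.
have -> : [set z in [:: x, y & s]] = [set x; y] :|: [set z in s].
  by apply/setP=> z; rewrite !inE orbA.
apply: leq_trans (matching_numberU _); last first.
  rewrite disjoint_subset; apply/subsetP=> z; rewrite !inE => /orP[]/eqP-> //.
  by move: nx; rewrite inE negb_or => /andP[].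
have -> : size [:: x, y & s] %/ 2 = 1 + size s %/ 2.
  by rewrite -(divnMDl 1 (size s)) // mul1n.
apply: leq_add (matching_number_edge exy) (IH _ _ us' _).
  by rewrite -ltnS (leq_trans _ sz) //= !ltnS ltnW.
exact: path_sorted ps'.
Qed.

Lemma mismatched_matching_number V v :
  mismatched e V v -> matching_number e V <= matching_number e (V :\ v).
Proof.
case/existsP=> M /andP[/andP[MM /eqP<-] nv]; have /andP[sM tM] := MM.
apply: leq_matching_number; rewrite /matching tM andbT.
apply/subsetP=> E EM; have EV := subsetP sM _ EM.
apply: (edges_induced EV); apply/subsetP=> x xE; rewrite !inE.
rewrite (subsetP (edge_sub EV) _ xE) andbT; apply: contraNneq nv => <-.
by apply/bigcupP; exists E.
Qed.

(** Adding the edge [uw] to a matching of the rest gives one inequality. For the other, at most one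
    edge of a matching contains [w], and an edge avoiding [w] also avoids [u], whose only neighbour
    is [w]. *)
Lemma matching_number_leaf V u w : u \in V -> neighbors e V u = [set w] ->
  matching_number e V = (matching_number e (V :\: [set u; w])).+1.
Proof.
move=> uV nu; have /and3P[_ wV euw] : adj e V u w.
  by have := set11 w; rewrite -nu inE.
apply/eqP; rewrite eqn_leq; apply/andP; split; last first.
  rewrite -add1n; apply: leq_trans (leq_add (matching_number_edge euw) (leqnn _)) _.
  apply: leq_trans (matching_numberU _) (matching_numberS _).
    by rewrite disjoint_sym disjoints_subset setDE subsetIr.
  by rewrite subUset subsetDl subUset !sub1set uV wV.
have [M MM <-] := matching_number_attained V; have /andP[sM tM] := MM.
rewrite -(cardsID [set E : {set T} | w \in E] M) -add1n.
apply: leq_add.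
  rewrite leqNgt; apply/card_gt1P=> -[E [F [EM FM nEF]]].
  move: EM FM; rewrite !inE => /andP[EM wE] /andP[FM wF].
  have := trivIsetP tM _ _ EM FM nEF; rewrite disjoint_subset.
  by move/subsetP/(_ _ wE); rewrite inE wF.
apply: leq_matching_number; rewrite /matching (trivIsetS (subsetDl _ _)) // andbT.
apply/subsetP=> E; rewrite !inE => /andP[nwE /(subsetP sM) EV].
apply: (edges_induced EV); apply/subsetP=> z zE; rewrite !inE.
rewrite (subsetP (edge_sub EV) _ zE) andbT negb_or.
rewrite [z == w](contraNF _ nwE) ?andbT; last by move/eqP<-.
apply: contraNneq nwE => zu; rewrite {z}zu in zE.
case/edgesP: EV zE => x [y [xV yV exy ->]]; rewrite !inE.
case/orP=> /eqP ux; move: xV yV exy; rewrite -ux => xV yV exy.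
  have: y \in neighbors e V u by rewrite inE; apply/and3P.
  by rewrite nu inE => /eqP->; rewrite eqxx orbT.
have: x \in neighbors e V u by rewrite inE; apply/and3P; rewrite e_sym.
by rewrite nu inE => /eqP->; rewrite eqxx.
Qed.

End Matchings.

(** * Forests and their leaves *)

Section Acyclic.
Variables (T : finType) (e : rel T).
Hypotheses (e_sym : symmetric e) (e_irr : irreflexive e).
Implicit Types (V A : {set T}) (x y u w : T).

(** The cycles of [e[V]] are the cycles of [e] with all vertices in [V]. Connectedness is not asked
    for, so [e[V]] is a forest. *)
Definition acyclic V := forall c, graph_cycle e c -> ~~ all (mem V) c.

Lemma acyclicS A V : A \subset V -> acyclic V -> acyclic A.
Proof.
move=> sAV acV c /acV; apply: contra; apply: sub_all => x; exact: (subsetP sAV).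
Qed.

Lemma adj_sym V : symmetric (adj e V).
Proof. by move=> x y; rewrite /adj /= e_sym andbCA. Qed.

Lemma connect_adj_sym V : connect_sym (adj e V).
Proof. exact/sym_connect_sym/adj_sym. Qed.

Lemma adj_sub V : subrel (adj e V) e.
Proof. by move=> x y /and3P[]. Qed.

Lemma path_adj_all V x p : path (adj e V) x p -> all (mem V) p.
Proof.
by elim: p x => //= y p IH x /andP[/and3P[_ yV _] /IH]; rewrite yV.
Qed.

Lemma acyclic_leaf V x y : acyclic V -> adj e V x y ->
  exists u w, u \in V /\ neighbors e V u = [set w].
Proof.
move=> acV axy.
(* Extend a simple path at its head until the head is a leaf; a second
   neighbour of the head lying on the path would close a cycle. *)
have: path (adj e V) x [:: y] by rewrite /= axy.
have: uniq [:: x; y].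
  by rewrite /= inE andbT; apply: contraTneq axy => ->; rewrite /adj /= e_irr !andbF.
(* The bound [#|T| <= n + size p] is kept during the extension; at [n = 0] it contradicts the
   [size p + 2] distinct vertices of the path. *)
have: #|T| <= #|T| + size (@nil T) by rewrite addn0.
move: {2}#|T| (@nil T) => n p; elim: n x y p {axy} => [|n IH] x y p szp Up pp.
  have /card_uniqP := Up; move: (max_card [in [:: x, y & p]]) => /[swap] -> /=.
  by move/leq_trans/(_ szp); rewrite add0n -[X in _ < X]addn0 => /ltnW; rewrite addn0 ltnn.
have /andP[axy _] := pp; have /and3P[xV yV exy] := axy.
have [nx|nx] := eqVneq (neighbors e V x) [set y]; first by exists x, y.
have [z axz nzy] : exists2 z, adj e V x z & z != y.
  apply/exists_inP; apply: contraR nx; rewrite negb_exists_in => /forall_inP H.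
  apply/eqP/setP=> z; rewrite in_set1 inE; apply/idP/eqP => [axz|->//].
  by apply/eqP; rewrite -[_ == _]negbK; apply: H.
have nzx : z != x by apply: contraTneq axz => ->; rewrite /adj /= e_irr !andbF.
have [zp|nzp] := boolP (z \in p); last first.
  apply: (IH z x (y :: p)); rewrite ?addnS //.
    by rewrite [uniq _]/= in_cons in_cons (negPf nzx) (negPf nzy) (negPf nzp).
  by rewrite -[path _ _ _]/(adj e V z x && path (adj e V) x (y :: p)) adj_sym axz.
case/splitPr: zp pp Up szp => p1 p2; rewrite -cat_rcons => pp Up _.
exfalso; suff: graph_cycle e [:: x, y & rcons p1 z].
  move/acV/negP; apply; have := path_adj_all pp.
  by rewrite -cat_cons all_cat => /andP[+ _]; rewrite [all _ (x :: _)]/= xV.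
rewrite /graph_cycle /= size_rcons /=; apply/andP; split; last first.
  by move: Up; rewrite -!cat_cons cat_uniq => /andP[].
move: pp; rewrite -cat_cons cat_path => /andP[/(sub_path (@adj_sub V)) /= /andP[-> pp] _].
by rewrite rcons_path pp last_rcons e_sym (adj_sub axz).
Qed.

(** A simple path in [A] from [y] to [z] closes up through [w] to a cycle, unless it is trivial. So
    [w] has at most one neighbour in each component of [A]. *)
Lemma acyclic_neighbors_connect V A w y z : acyclic V -> A \subset V :\ w ->
  w \in V -> y \in A -> e w y -> e w z -> connect (adj e A) y z -> y = z.
Proof.
move=> acV sA wV yA ewy ewz /connectP[p pp zE]; apply/eqP/negPn/negP => nyz.
case/shortenP: pp zE => q pq Uq _ zE.
have qA := path_adj_all pq.
have nwA : w \notin A by apply/negP => /(subsetP sA); rewrite !inE eqxx.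
have sAV : {subset A <= V} by move=> t /(subsetP sA); rewrite !inE => /andP[].
suff: graph_cycle e [:: w, y & q].
  move/acV/negP; apply; rewrite /= wV sAV //=; apply: sub_all qA => t; exact: sAV.
rewrite /graph_cycle; apply/andP; split.
  by case: q zE {pq Uq qA} => //= zE; rewrite zE eqxx in nyz.
rewrite /ucycleb [cycle _ _]/= rcons_path ewy (sub_path (@adj_sub A)) //=.
rewrite -zE e_sym ewz /=; apply/andP; split => //.
rewrite inE negb_or; apply/andP; split.
  by apply: contraNneq nwA => ->.
by apply: contra nwA => /(allP qA).
Qed.

End Acyclic.

(** * Support, core and [N]-forest under leaf deletion *)

Section Support.
Variables (T : finType) (e : rel T) (R : realType).
Hypotheses (e_sym : symmetric e) (e_irr : irreflexive e).
Implicit Types (V : {set T}) (f g : T -> R) (u w y z : T).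
Import GRing.Theory.
Local Open Scope ring_scope.

(** Vectors are functions on all of [T], unconstrained outside [V], so that the same function can be
    tested on several vertex sets, unlike a column indexed by ['I_#|V|]. *)
Definition null_vector V f :=
  forall z, z \in V -> \sum_(y in V | e z y) f y = 0.

Lemma SuppP V u :
  reflect (u \in V /\ exists2 f, null_vector V f & f u != 0) (u \in Supp e R V).
Proof.
have sumE z f : \sum_(y in V | e z y) f y =
    \sum_(j < #|V|) (e z (enum_val j))%:R * f (enum_val j).
  rewrite -(big_enum_val (fun y => (e z y)%:R * f y)) big_mkcondr.
  by apply: eq_bigr => y _; case: (e z y); rewrite ?mul1r ?mul0r.
apply: (iffP imsetP) => [[i]|[uV [f f0 fu]]].
  rewrite inE => /asboolP[x x0 xi] ->; split; first exact: enum_valP.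
  (* The sum has one term for [y] in [V] and none otherwise: [x] is extended by zero. *)
  pose f y : R := \sum_(j | enum_val j == y) x j ord0.
  have fE j : f (enum_val j) = x j ord0.
    by apply: big_pred1 => k; rewrite /= (inj_eq enum_val_inj).
  exists f; last by rewrite fE.
  move=> z zV; rewrite sumE.
  move/matrixP/(_ (enum_rank_in zV z) ord0): x0; rewrite !mxE => E.
  rewrite -[RHS]E; apply: eq_bigr => j _.
  by rewrite !mxE enum_rankK_in // fE.
exists (enum_rank_in uV u); last by rewrite enum_rankK_in.
rewrite inE; apply/asboolP; exists (\col_j f (enum_val j)); last first.
  by rewrite mxE enum_rankK_in.
apply/matrixP=> i j; rewrite !mxE -[RHS](f0 _ (enum_valP i)) sumE.
by apply: eq_bigr => k _; rewrite !mxE.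
Qed.

Lemma Supp_sub V : Supp e R V \subset V.
Proof. by apply/subsetP=> u /SuppP[]. Qed.

Lemma CoreP V z :
  reflect (z \in V /\ exists2 s, s \in Supp e R V & e s z) (z \in Core e R V).
Proof.
apply: (iffP bigcupP) => [[s sS]|[zV [s sS esz]]].
  by rewrite inE => /and3P[_ zV esz]; split=> //; exists s.
by exists s; rewrite // inE; apply/and3P; rewrite (subsetP (Supp_sub V)).
Qed.

Lemma Core_sub V : Core e R V \subset V.
Proof. by apply/subsetP=> u /CoreP[]. Qed.

Lemma Supp_component V y : y \in Supp e R V ->
  exists f, [/\ null_vector V f, f y != 0 &
    forall z, f z != 0 -> connect (adj e V) y z].
Proof.
case/SuppP=> yV [f f0 fy].
exists (fun z => if connect (adj e V) y z then f z else 0).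
split; last 2 first.
- by rewrite connect0.
- by move=> z; case: ifP => //; rewrite eqxx.
(* Neighbours of [z] in [V] share its component, so the restriction leaves the sum at [z] unchanged
   or makes all its terms zero. *)
move=> z zV; have con t : (t \in V) && e z t ->
    connect (adj e V) y t = connect (adj e V) y z.
  case/andP=> tV ezt; have azt : adj e V z t by apply/and3P.
  apply/idP/idP => H; apply: connect_trans H (connect1 _) => //.
  by rewrite adj_sym.
have [yz|yz] := boolP (connect (adj e V) y z).
  rewrite -[RHS](f0 z zV); apply: eq_bigr => t /con ->; by rewrite yz.
by apply: big1 => t /con ->; rewrite (negPf yz).
Qed.

Section Leaf.
Variables (V : {set T}) (u w : T).
Hypotheses (uV : u \in V) (u_leaf : neighbors e V u = [set w]).
Let V' := V :\: [set u; w].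

Let wV : w \in V.
Proof. by have := set11 w; rewrite -u_leaf inE => /and3P[]. Qed.

Let euw : e u w.
Proof. by have := set11 w; rewrite -u_leaf inE => /and3P[]. Qed.

Let e_u z : z \in V -> e z u = (z == w).
Proof.
move=> zV; apply/idP/eqP => [ezu|->]; last by rewrite e_sym.
by apply/set1P; rewrite -u_leaf inE; apply/and3P; rewrite e_sym.
Qed.

Let nuw : u != w.
Proof. by apply: contraTneq euw => ->; rewrite e_irr. Qed.

Lemma sum_leaf f z : \sum_(y in V | e z y) f y =
  (e z u)%:R * f u + (e z w)%:R * f w + \sum_(y in V' | e z y) f y.
Proof.
have natE (b : bool) (a : R) : (if b then a else 0) = b%:R * a.
  by case: b; rewrite ?mul1r ?mul0r.
rewrite big_mkcondr (bigD1 u) //= (bigD1 w) /=; last by rewrite wV eq_sym.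
rewrite !natE addrA; congr (_ + _); rewrite [RHS]big_mkcondr /=.
apply: eq_bigl => y; rewrite !inE negb_or.
by case: (y \in V); case: (y != u); case: (y != w).
Qed.

(** The equation at [u] reads [f w = 0], the one at [w] determines [f u], and in the remaining ones
    the term of [w] vanishes. *)
Lemma null_vector_leaf f : null_vector V f <->
  [/\ null_vector V' f, f w = 0 & f u = - \sum_(y in V' | e w y) f y].
Proof.
have V'V z : z \in V' -> [/\ z \in V, z != u & z != w].
  by rewrite !inE negb_or => /andP[/andP[]].
have su : \sum_(y in V' | e u y) f y = 0.
  apply: big1 => y /andP[/V'V[yV _ nyw]]; rewrite e_sym e_u //.
  by rewrite (negPf nyw).
split=> [f0|[f0 fw fu] z zV].
  have fw : f w = 0.
    by have := f0 u uV; rewrite sum_leaf e_irr euw su mul0r mul1r add0r addr0.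
  split=> // [z zV'|].
    have [zV _ nzw] := V'V z zV'; have := f0 z zV.
    by rewrite sum_leaf fw e_u // (negPf nzw) mul0r mulr0 !add0r.
  apply/eqP; rewrite -addr_eq0.
  by have := f0 w wV; rewrite sum_leaf e_irr e_sym euw mul1r mul0r addr0 => ->.
rewrite sum_leaf fw mulr0 addr0 e_u //.
have [->|nzw] := eqVneq z w; first by rewrite mul1r fu addNr.
rewrite mul0r add0r; have [->//|nzu] := eqVneq z u.
by apply: f0; rewrite !inE negb_or nzu nzw.
Qed.

(** This separates the two cases of the leaf deletion. *)
Let touched := [exists y in Supp e R V', e w y].

(** By [null_vector_leaf] the values at [u] and [w] are dictated by those on [V'], so [g] is
    overwritten at these two vertices. *)
Lemma null_vector_extend g : null_vector V' g ->
  exists f, [/\ null_vector V f, {in V', f =1 g} &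
    f u = - \sum_(y in V' | e w y) g y].
Proof.
move=> g0; pose f y := if y == w then 0 else
  if y == u then - \sum_(y in V' | e w y) g y else g y.
have fg : {in V', f =1 g}.
  by move=> y; rewrite /f !inE negb_or; do 2![case: eqP => //=].
have sf z : \sum_(y in V' | e z y) f y = \sum_(y in V' | e z y) g y.
  by apply: eq_bigr => y /andP[/fg].
have fu : f u = - \sum_(y in V' | e w y) g y by rewrite /f (negPf nuw) eqxx.
exists f; split=> //; apply/null_vector_leaf; split.
- by move=> z zV'; rewrite sf g0.
- by rewrite /f eqxx.
- by rewrite sf.
Qed.

Lemma Supp_leaf_in y : y \in V' -> (y \in Supp e R V) = (y \in Supp e R V').
Proof.
move=> yV'; apply/SuppP/SuppP => -[yV [f f0 fy]]; split=> //.
- by exists f => //; case/null_vector_leaf: f0.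
- by move: yV'; rewrite inE => /andP[].
- by have [g [g0 gf _]] := null_vector_extend f0; exists g; rewrite ?gf.
Qed.

Lemma Supp_leaf_neighbor : w \notin Supp e R V.
Proof. by apply/SuppP => -[_ [f /null_vector_leaf[_ -> _]]]; rewrite eqxx. Qed.

(** If [f u] is nonzero, so is some term of the sum that defines it. Conversely, a null vector
    living on the component of [y] meets the neighbours of [w] only in [y], so nothing cancels in
    the sum. *)
Lemma Supp_leaf : acyclic e V -> (u \in Supp e R V) = touched.
Proof.
move=> acV; apply/SuppP/exists_inP => [[_ [f /null_vector_leaf[f0 fw fu]]]|].
  rewrite fu oppr_eq0 => nz.
  have /exists_inP[y yV' fy] : [exists (y | (y \in V') && e w y), f y != 0].
    apply: contraR nz; rewrite negb_exists_in => /forall_inP H.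
    by apply/eqP/big1 => y /H; rewrite negbK => /eqP.
  case/andP: yV' => yV' ewy; exists y => //; apply/SuppP; split=> //.
  by exists f.
case=> y yS ewy; have [g [g0 gy gc]] := Supp_component yS.
have yV' := subsetP (Supp_sub V') y yS.
split=> //; have [f [f0 _ fu]] := null_vector_extend g0; exists f => //.
rewrite fu oppr_eq0 (bigD1 y) /= ?yV' // big1 ?addr0 // => t /andP[/andP[tV' ewt] nty].
apply/eqP; apply: contraNT nty => /gc cyt; apply/eqP/esym.
apply: (acyclic_neighbors_connect e_sym acV _ wV yV' ewy ewt cyt).
by apply/subsetP=> z; rewrite !inE negb_or => /andP[/andP[_ ->]].
Qed.

Lemma Supp_leafE : acyclic e V ->
  Supp e R V = if touched then u |: Supp e R V' else Supp e R V'.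
Proof.
move=> acV; apply/setP=> z; have [->|nzu] := eqVneq z u.
  rewrite Supp_leaf //; case: ifP; rewrite ?inE ?eqxx // => _.
  by apply/esym/negP => /(subsetP (Supp_sub _)); rewrite !inE eqxx.
have -> : (z \in if touched then u |: Supp e R V' else Supp e R V') =
    (z \in Supp e R V') by case: ifP; rewrite // !inE (negPf nzu).
have [zV'|nzV'] := boolP (z \in V'); first exact: Supp_leaf_in.
rewrite [RHS](contraNF _ nzV'); last exact: (subsetP (Supp_sub _)).
apply/negP => zS; move: nzV'; rewrite !inE (subsetP (Supp_sub _) _ zS) andbT negbK.
rewrite (negPf nzu) /= => /eqP zw; move: zS; rewrite zw.
by rewrite (negPf Supp_leaf_neighbor).
Qed.

(** The only possible new support vertex is [u], whose sole neighbour is [w]; hence membership can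
    change only at [w], and [w] has a neighbour in the support exactly when [touched] holds. *)
Lemma Core_leafE : acyclic e V ->
  Core e R V = if touched then w |: Core e R V' else Core e R V'.
Proof.
move=> acV; apply/setP=> z; have [->|nzw] := eqVneq z w.
  have -> : (w \in if touched then w |: Core e R V' else Core e R V') = touched.
    case: ifP; rewrite ?inE ?eqxx // => _.
    by apply/negP => /(subsetP (Core_sub _)); rewrite !inE eqxx orbT.
  apply/CoreP/idP => [[_ [s sS esw]]|tt]; last first.
    by split=> //; exists u; rewrite ?Supp_leaf.
  move: sS; rewrite Supp_leafE //; case: ifP => // nt sS.
  by rewrite -nt; apply/exists_inP; exists s; rewrite // e_sym.
have -> : (z \in if touched then w |: Core e R V' else Core e R V') =
    (z \in Core e R V') by case: ifP; rewrite // !inE (negPf nzw).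
apply/CoreP/CoreP => -[zV [s sS esz]].
  have sV := subsetP (Supp_sub _) _ sS.
  (* A neighbour [s] of [u] would be [w], which is never in the support. *)
  have nzu : z != u.
    apply: contraTneq esz => ->; rewrite e_u //.
    by apply: contraNneq Supp_leaf_neighbor => <-.
  have nsw : s != w by apply: contraNneq Supp_leaf_neighbor => <-.
  have nsu : s != u by apply: contraNneq nzw => su; rewrite -e_u // e_sym -su.
  split; first by rewrite !inE negb_or nzu nzw.
  by exists s; rewrite -?Supp_leaf_in // !inE negb_or nsu nsw.
split; first by move: zV; rewrite inE => /andP[].
by exists s; rewrite // Supp_leaf_in // (subsetP (Supp_sub _)).
Qed.

(** When [touched] holds, [u] enters the support and [w] the core, so both lie in the [S]-forest;
    otherwise neither does. *)
Lemma N_forest_leafE : acyclic e V ->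
  N_forest e R V =
    if touched then N_forest e R V' else [set u; w] :|: N_forest e R V'.
Proof.
move=> acV; rewrite /N_forest /S_forest -!/(Core e R _) Supp_leafE // Core_leafE //.
have uS : u \notin Supp e R V'.
  by apply/negP => /(subsetP (Supp_sub _)); rewrite !inE eqxx.
have wS : w \notin Supp e R V'.
  by apply/negP => /(subsetP (Supp_sub _)); rewrite !inE eqxx orbT.
have uC : u \notin Core e R V'.
  by apply/negP => /(subsetP (Core_sub _)); rewrite !inE eqxx.
have wC : w \notin Core e R V'.
  by apply/negP => /(subsetP (Core_sub _)); rewrite !inE eqxx orbT.
case: ifP => _; apply/setP=> z; rewrite ?in_setU !in_setD !in_setU !in_set1.
  by case: (z == u); case: (z == w); rewrite /= ?orbT ?andbF.
have [->|_] := eqVneq z u; first by rewrite (negPf uS) (negPf uC) uV.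
by have [->|_] := eqVneq z w; first by rewrite (negPf wS) (negPf wC) wV.
Qed.

End Leaf.

(** Deleting a leaf and its neighbour lowers both sides by 2: the core loses one vertex or the
    [N]-forest loses two. The identity is doubled to stay within the natural numbers. *)
Lemma acyclic_matching_number V : acyclic e V ->
  (2 * matching_number e V = 2 * #|Core e R V| + #|N_forest e R V|)%N.
Proof.
have [n] := ubnP #|V|; elim: n V => // n IH V cV acV.
have [/existsP[x /existsP[y axy]]|noedge] :=
    boolP [exists x, exists y, adj e V x y].
  have [u [w [uV u_leaf]]] := acyclic_leaf e_sym e_irr acV axy.
  set V' := V :\: [set u; w].
  have sV' : V' \subset V by apply: subsetDl.
  have uV' : u \notin V' by rewrite !inE eqxx.
  have wV' : w \notin V' by rewrite !inE eqxx orbT.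
  have nuw : u != w.
    have : w \in neighbors e V u by rewrite u_leaf inE.
    by apply: contraTneq => ->; rewrite inE /adj /= e_irr !andbF.
  have cV' : (#|V'| < n)%N.
    rewrite -ltnS; apply: leq_trans cV; rewrite ltnS; apply: proper_card.
    by apply/properP; split=> //; exists u.
  rewrite (matching_number_leaf e_sym e_irr uV u_leaf) mulnS.
  rewrite (IH V' cV' (acyclicS sV' acV)) (Core_leafE uV u_leaf acV).
  rewrite (N_forest_leafE uV u_leaf acV) -/V'; case: ifP => _.
    rewrite cardsU1 (contra (subsetP (Core_sub _) _) wV') add1n mulnS.
    by rewrite addnA.
  rewrite cardsU cards2 nuw disjoint_setI0 ?cards0 ?subn0 1?addnCA //.
  rewrite disjoints_subset subUset !sub1set !inE !eqxx orbT /=.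
  by rewrite ?andbF.
have noe x y : x \in V -> y \in V -> e x y = false.
  move=> xV yV; apply: contraNF noedge => exy; apply/existsP; exists x.
  by apply/existsP; exists y; apply/and3P.
(* Without edges every vector is null, in particular the constant 1. *)
have SV : Supp e R V = V.
  apply/setP=> z; apply/SuppP/idP => [[]//|zV]; split=> //.
  exists (fun=> 1); last exact: oner_neq0.
  by move=> t tV; apply: big1 => y /andP[yV]; rewrite noe.
have -> : N_forest e R V = set0.
  by apply/eqP; rewrite setD_eq0 /S_forest SV subsetUl.
have -> : Core e R V = set0.
  apply/setP=> z; rewrite inE; apply/CoreP => -[zV [s sS]].
  by rewrite noe // -SV.
rewrite cards0 muln0; have [M /andP[sM _] <-] := matching_number_attained e V.
suff -> : M = set0 by rewrite cards0.
apply/setP=> E; rewrite inE; apply/negP => /(subsetP sM)/edgesP[x [y [xV yV]]].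
by rewrite noe.
Qed.

End Support.

(** * Connectedness and components *)

Section Components.
Variables (T : finType) (e : rel T).
Hypotheses (e_sym : symmetric e) (e_irr : irreflexive e).
Implicit Types (V A B K : {set T}).

Lemma connect_adjS A B x y :
  A \subset B -> connect (adj e A) x y -> connect (adj e B) x y.
Proof.
move=> /subsetP sAB; apply: connect_sub => a b /and3P[aA bA eab].
by apply: connect1; apply/and3P; rewrite !sAB.
Qed.

Lemma connectedP V :
  reflect {in V &, forall x y, connect (adj e V) x y} (connected e V).
Proof.
apply: (iffP forall_inP) => [H x y xV yV|H x xV].
  exact: (forall_inP (H x xV)).
by apply/forall_inP => y yV; apply: H.
Qed.

Lemma connectedU A B a b : connected e A -> connected e B ->
  a \in A -> b \in B -> e a b -> connected e (A :|: B).
Proof.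
move=> /connectedP cA /connectedP cB aA bB eab.
have to_a x : x \in A :|: B -> connect (adj e (A :|: B)) x a.
  rewrite inE => /orP[xA|xB].
    by apply: connect_adjS (subsetUl _ _) _; apply: cA.
  apply: connect_trans (connect_adjS (subsetUr _ _) (cB x b xB bB)) (connect1 _).
  by apply/and3P; rewrite !inE aA bB orbT e_sym.
apply/connectedP=> x y /to_a xa /to_a.
by rewrite connect_adj_sym //; apply: connect_trans.
Qed.

(** A path in [e[V]] that starts in the component never leaves it. For [y] outside [V] the set is
    just the singleton of [y]. *)
Lemma connected_component V y : connected e [set z | connect (adj e V) y z].
Proof.
set K := [set z | _].
have inK x p : x \in K -> path (adj e V) x p -> path (adj e K) x p.
  elim: p x => //= t p IH x xK /andP[axt pp].
  have tK : t \in K by move: xK; rewrite !inE => /connect_trans; apply; apply: connect1.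
  by rewrite (IH t tK pp) andbT /adj /= xK tK; case/and3P: axt.
have fromy x : x \in K -> connect (adj e K) y x.
  move=> xK; have yK : y \in K by rewrite inE connect0.
  move: xK; rewrite inE => /connectP[p pp ->]; apply/connectP.
  by exists p => //; apply: inK.
apply/connectedP=> x z /fromy; rewrite connect_adj_sym // => xy /fromy.
exact: connect_trans.
Qed.

Lemma components_partition V : partition (components e V) V.
Proof.
apply: equivalence_partitionP => x y z _ _ _; split; first exact: connect0.
move=> xy; apply/idP/idP; apply: connect_trans => //.
by rewrite connect_adj_sym.
Qed.

Lemma matching_number_components V :
  matching_number e V = \sum_(K in components e V) matching_number e K.
Proof.
have /and3P[/eqP cV tV _] := components_partition V.
apply/eqP; rewrite eqn_leq; apply/andP; split; last first.
  apply: (@matching_number_bigcup T e e_irr _ (mem (components e V)) id).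
    by move=> K KV; rewrite -cV; apply: bigcup_sup.
  by move=> K L KV LV; apply: (trivIsetP tV).
(* The covering lemma is used with the empty set as its distinguished part, which contributes 0. *)
have cov (E : {set T}) : E \in edges e V -> E \in edges e set0 \/
    exists2 K, K \in components e V & E \in edges e K.
  move=> EV; right; have /edgesP[x [y [xV yV exy EE]]] := EV.
  exists [set z in V | connect (adj e V) x z]; first by apply/imsetP; exists x.
  apply: (edges_induced EV); rewrite EE subUset !sub1set !inE xV yV connect0 /=.
  by apply: connect1; apply/and3P.
apply: leq_trans (matching_number_cover cov) _.
have := matching_number_half e_irr (set0 : {set T}).
by rewrite cards0 div0n leqn0 => /eqP->.
Qed.

(** The edge wanted is the first one of the path that leaves [V]. *)
Lemma exit_edge V y p : path e y p -> y \in V -> last y p \notin V ->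
  exists k v, [/\ connect (adj e V) y k, v \notin V & e k v].
Proof.
elim: p y => [|t p IH] y /= => [_ ->//|/andP[eyt pp] yV lV].
have [tV|ntV] := boolP (t \in V); last by exists y, t; rewrite connect0.
have [k [v [tk nv ekv]]] := IH t pp tV lV; exists k, v; split=> //.
by apply: connect_trans tk; apply: connect1; apply/and3P.
Qed.

End Components.

(** * The cycle and the pendant trees of a unicyclic graph *)

Section Unicyclic.
Variables (T : finType) (e : rel T) (c : seq T).
Hypotheses (e_sym : symmetric e) (e_irr : irreflexive e).
Hypotheses (e_unicyclic : unicyclic e) (c_cycle : graph_cycle e c).
Let C := cycle_vertices c.
Let P := pendant_tree e c.

Let c_uniq : uniq c.
Proof. by case/and3P: c_cycle. Qed.

(** Uniqueness concerns edge sets only; vertices are recovered from them, since each vertex [x] of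
    [d] lies on the edge to [next d x]. *)
Lemma unicyclic_cycle_sub d : graph_cycle e d -> {subset d <= c}.
Proof.
move=> d_cycle x xd; have [_ [E [_ Euniq]]] := e_unicyclic.
have edE : cycle_edges d = cycle_edges c.
  by transitivity E; [apply/esym|]; apply: Euniq; [exists d | exists c].
have : [set x; next d x] \in cycle_edges c by rewrite -edE; apply/imsetP; exists x.
case/imsetP=> y yc /setP/(_ x); rewrite !inE eqxx /= => /esym/orP[]/eqP->//.
by rewrite mem_next.
Qed.

Lemma acyclic_off_cycle : acyclic e (~: C).
Proof.
move=> d d_cycle; have dc := unicyclic_cycle_sub d_cycle.
case: d d_cycle dc => [//|x d] _ dc; rewrite /= in_setC inE.
by rewrite dc ?mem_head.
Qed.

Lemma cycle_matching_number : matching_number e C = #|C| %/ 2.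
Proof.
apply/eqP; rewrite eqn_leq matching_number_half //=.
rewrite /C /cycle_vertices cardsE (card_uniqP c_uniq).
(* Dropping the closing edge turns the cycle into a path through all of [C]. *)
apply: matching_number_path => //; case/and3P: c_cycle => _ + _.
by case: c => //= x s; rewrite rcons_path => /andP[].
Qed.

Lemma pendant_treeP v : v \in C ->
  [/\ connected e (P v), P v :&: C = [set v] &
    forall Q, connected e Q -> Q :&: C = [set v] -> #|Q| <= #|P v|].
Proof.
move=> vC; rewrite /P /pendant_tree; case: arg_maxnP => [|Q /andP[cQ /eqP QC] Qmax].
  apply/andP; split; last by rewrite -/C; apply/eqP/setIidPl; rewrite sub1set.
  by apply/connectedP => x y /set1P-> /set1P->; apply: connect0.
by split=> // Q' cQ' Q'C; apply: Qmax; rewrite cQ' Q'C eqxx.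
Qed.

Lemma pendant_tree_root v : v \in C -> v \in P v.
Proof.
by case/pendant_treeP=> _ /setP/(_ v) + _; rewrite !inE eqxx => /andP[].
Qed.

Lemma pendant_tree_cycle v x : v \in C -> x \in P v -> x \in C -> x = v.
Proof.
case/pendant_treeP=> _ /setP/(_ x) + _ xP xC.
by rewrite in_setI xP xC => /esym/set1P.
Qed.

(** Adjoining [K] keeps the tree connected and its trace on [C] equal to [v], so by maximality [K]
    was already inside. *)
Lemma pendant_tree_absorb v k K : v \in C -> connected e K ->
  [disjoint K & C] -> k \in K -> e v k -> K \subset P v.
Proof.
move=> vC cK dK kK evk; have [cP PC Pmax] := pendant_treeP vC.
have cPK := connectedU e_sym cP cK (pendant_tree_root vC) kK evk.
have PKC : (P v :|: K) :&: C = [set v].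
  by rewrite setIUl PC (disjoint_setI0 dK) setU0.
have := Pmax _ cPK PKC => le.
have /eqP-> : P v == P v :|: K by rewrite eqEcard subsetUl.
exact: subsetUr.
Qed.

(** An edge not inside [C] has an end [y] off [C]. The component of [y] in [~: C] is absorbed by the
    pendant tree at any cycle vertex adjacent to it: the other end if that is on [C], or else one
    found through connectedness. *)
Lemma edge_pendant_tree (E : {set T}) : E \in edges e [set: T] ->
  E \in edges e C \/ exists2 v, v \in C & E \in edges e (P v).
Proof.
move=> ET; have /edgesP[x [y [_ _ exy EE]]] := ET.
have [sEC|] := boolP (E \subset C); first by left; apply: edges_induced ET _.
rewrite {1}EE subUset !sub1set negb_and => nC; right.
wlog nyC : x y exy EE nC / y \notin C.
  move=> W; case/orP: (nC) => H; last exact: W nC H.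
  by apply: (W y x) => //; rewrite 1?e_sym 1?orbC // setUC.
pose K := [set z | connect (adj e (~: C)) y z].
have cK : connected e K by apply: connected_component.
have yK : y \in K by rewrite inE connect0.
have dK : [disjoint K & C].
  rewrite disjoints_subset; apply/subsetP=> z; rewrite inE => /connectP[p pp ->].
  have pA := path_adj_all pp; have := mem_last y p; rewrite inE => /orP[/eqP->|].
    by rewrite inE.
  exact: (allP pA).
have [xC|nxC] := boolP (x \in C).
  exists x => //; apply: (edges_induced ET); rewrite EE subUset !sub1set.
  rewrite pendant_tree_root //=.
  exact: (subsetP (pendant_tree_absorb xC cK dK yK exy)).
have xK : x \in K.
  by rewrite inE connect1 //; apply/and3P; rewrite !in_setC nxC nyC e_sym.
(* A path from [y] to the cycle leaves [~: C] along an edge from [k] to [v]. *)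
have [v vC [k kK evk]] : exists2 v, v \in C & exists2 k, k \in K & e v k.
  have /hasP[c0 c0c _] : has predT c.
    by rewrite has_predT; case/andP: c_cycle => /ltnW/ltnW.
  have [/connectedP cT _] := e_unicyclic.
  have /connectP[p pp pE] := cT y c0 (in_setT _) (in_setT _).
  have [||k [v [yk nv ekv]]] := @exit_edge _ e (~: C) y p (sub_path (@adj_sub _ e setT) pp).
  - by rewrite in_setC.
  - by rewrite -pE in_setC negbK inE.
  - by exists v; rewrite ?in_setC ?negbK // in nv *; exists k; rewrite ?inE // e_sym.
exists v => //; apply: (edges_induced ET); rewrite EE subUset !sub1set.
by rewrite !(subsetP (pendant_tree_absorb vC cK dK kK evk)).
Qed.

Lemma pendant_tree_disjoint v w : v \in C -> w \in C -> v != w ->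
  [disjoint P v & P w].
Proof.
move=> vC wC nvw; rewrite -setI_eq0; apply/set0Pn => -[z /setIP[zv zw]].
have [/connectedP cv _ _] := pendant_treeP vC.
have [/connectedP cw _ _] := pendant_treeP wC.
have vv := pendant_tree_root vC; have ww := pendant_tree_root wC.
(* Each step of [r] stays inside one of the two trees, so a path for [r] can meet [C] only in [v]
   and [w]. *)
pose r := relU (adj e (P v)) (adj e (P w)).
have re : subrel r e by move=> x y /orP[]; apply: adj_sub.
have : connect r v w.
  apply: (@connect_trans _ _ z).
    by apply: connect_sub (cv v z vv zv) => a b ab; apply: connect1; rewrite /= ab.
  apply: connect_sub (cw z w zw ww) => a b ab; apply: connect1.
  by rewrite /= ab orbT.
case/connectP=> p0 /shortenP[p pp Up _] {p0}; case/lastP: p pp Up => [|q w'].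
  by move=> _ _ /= wv; rewrite wv eqxx in nvw.
rewrite last_rcons => pp Up ww'; rewrite -{w'}ww' in pp Up.
have rC a b : r a b -> b \in C -> b = v \/ b = w.
  by case/orP=> /and3P[_ bP _] bC; [left|right]; apply: pendant_tree_cycle bP bC.
have pC a s x : path r a s -> x \in s -> x \in C -> x = v \/ x = w.
  elim: s a => //= t s IH a /andP[rat ps].
  rewrite inE => /orP[/eqP->|xs]; [exact: rC rat | exact: (IH t)].
have /and3P[nvq nwq Uq] : [&& v \notin rcons q w, w \notin q & uniq q].
  by move: Up; rewrite cons_uniq rcons_uniq.
have qC x : x \in q -> x \notin C.
  move=> xq; apply/negP => xC; case: (pC _ _ _ pp _ xC) => [|xv|xw].
  - by rewrite mem_rcons inE xq orbT.
  - by move: nvq; rewrite mem_rcons inE -xv xq orbT.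
  - by rewrite -xw xq in nwq.
have [vc wc] : v \in c /\ w \in c by move: vC wC; rewrite !inE.
(* The arc [w :: p2] of the cycle leads back from [w] to [v]; it closes up the path through [q]. *)
have [i p1 p2 _ _ rotE] := rot_to_arc c_uniq vc wc nvw.
have /and3P[_ cyc _] := c_cycle.
move: cyc; rewrite -(rot_cycle i) rotE /= rcons_cat cat_path => /andP[_ /=].
rewrite rcons_path => /and3P[_ p2path p2v].
have := c_uniq; rewrite -(rot_uniq i) rotE -cat_cons cat_uniq => /and3P[_ dis Uw].
have memc x : x \in w :: p2 -> x \in C.
  by move=> xs; rewrite inE -(mem_rot i) rotE inE mem_cat xs !orbT.
have nvs : v \notin w :: p2.
  by apply: contra dis => vs; apply/hasP; exists v; rewrite ?mem_head.
(* With [q] empty, a single step of [r] would put [v] and [w] into the same tree. *)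
have q_ne : q != [::].
  apply/eqP => q0; move: pp; rewrite q0 /= andbT => /orP[/and3P[_ wP _]|/and3P[vP _ _]].
    by rewrite (pendant_tree_cycle vC wP wC) eqxx in nvw.
  by rewrite (pendant_tree_cycle wC vP vC) eqxx in nvw.
have d_cycle : graph_cycle e (v :: rcons q w ++ p2).
  apply/and3P; split.
  - by rewrite /= size_cat size_rcons; case: (q) q_ne.
  - rewrite /= rcons_cat cat_path (sub_path re) //= last_rcons rcons_path.
    by rewrite p2path.
  - rewrite cat_rcons cons_uniq mem_cat negb_or nvs andbT; apply/andP; split.
      by move: nvq; rewrite mem_rcons inE negb_or => /andP[].
    rewrite cat_uniq Uq Uw andTb andbT.
    by apply/hasPn => x /memc xC; apply: contraL xC; apply: qC.
(* The first vertex of [q] is off [C] although it lies on a cycle. *)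
have := unicyclic_cycle_sub d_cycle.
case: q q_ne qC {pp Up pC nvq nwq Uq d_cycle} => // a q _ /(_ a (mem_head _ _)).
by rewrite inE => /negP na /(_ a) ac; apply: na; apply: ac; rewrite !inE eqxx orbT.
Qed.

(** For the upper bound, [C] and the pendant trees cover all edges; the mismatched roots are deleted
    at no cost, which leaves disjoint subsets of [~: C]. The lower bound joins matchings of [C] and
    [~: C]. *)
Lemma typeII_matching_number : typeII e c ->
  matching_number e [set: T] = #|C| %/ 2 + matching_number e (~: C).
Proof.
move=> tII; apply/eqP; rewrite eqn_leq -cycle_matching_number; apply/andP; split.
  apply: leq_trans (matching_number_cover edge_pendant_tree) _; rewrite leq_add2l.
  have /leq_trans: \sum_(v in C) matching_number e (P v) <=
      \sum_(v in C) matching_number e (P v :\ v).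
    apply: leq_sum => v vC; apply: mismatched_matching_number.
    apply: contraR tII => nm; by apply/exists_inP; exists v.
  apply; apply: matching_number_bigcup => // [v vC|v w vC wC nvw].
    apply/subsetP=> x; rewrite !inE => /andP[nxv xP].
    apply: contra nxv => xc; apply/eqP; apply: (pendant_tree_cycle vC xP).
    by rewrite inE.
  apply: disjointWl (subsetDl _ _) (disjointWr (subsetDl _ _) _).
  exact: pendant_tree_disjoint.
rewrite -(setUCr C); apply: matching_numberU => //.
by rewrite disjoints_subset setCK.
Qed.

End Unicyclic.

(** * The formula over the components of the complement of the cycle *)

Import GRing.Theory.
Local Open Scope ring_scope.

Theorem theorem5p4 (R : realType) (T : finType) (e : rel T) (c : seq T)
    (e_simple : simple_graph e) (e_unicyclic : unicyclic e)
    (c_cycle : graph_cycle e c) (e_typeII : typeII e c) :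
  (matching_number e [set: T])%:R =
    (#|cycle_vertices c| %/ 2)%N%:R
    + \sum_(K in components e (~: cycle_vertices c))
        (#|Core e R K|%:R + #|N_forest e R K|%:R / 2) :> R.
Proof.
have [e_sym e_irr] := e_simple.
rewrite (typeII_matching_number e_sym e_irr e_unicyclic c_cycle e_typeII) natrD.
congr (_ + _); rewrite matching_number_components // natr_sum.
apply: eq_bigr => K KV.
have /and3P[/eqP cV _ _] := components_partition e_sym (~: cycle_vertices c).
have sK : K \subset ~: cycle_vertices c by rewrite -cV; apply: bigcup_sup.
have acK := acyclicS sK (acyclic_off_cycle e_unicyclic c_cycle).
(* Each summand is compared after multiplication by 2, where the forest identity in the natural
   numbers applies. *)
have n2 : (2 : R) != 0 by rewrite Num.Theory.pnatr_eq0.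
have /(congr1 (fun n => n%:R : R)) := acyclic_matching_number R e_sym e_irr acK.
rewrite natrD !natrM => E; apply: (mulfI n2).
by rewrite E mulrDr mulrCA divff // mulr1.
Qed.
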